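(* For any recursive function $h:\omega\to\omega$, there exists $G:\omega\to\omega$ which is relatively $\mathsf{DNR}$ such that for each Turing functional $\Phi$ and each $i\in\omega$, $\Phi^{G_0\oplus\cdots\oplus G_i}$ is not an $h$-$\mathsf{DNR}$ function.
   Context: Let $(\Phi_n)_{n\in\omega}$ be a standard enumeration of Turing functionals. For $G:\omega\to\omega$ and $n\in\omega$, the $n$th column of $G$ is $G_n:\omega\to\omega$, $G_n(k)=G(2^n(2k+1))$; conversely $\oplus_n G_n$ denotes the function $G$ with $G(2^n(2k+1))=G_n(k)$, and $G_0\oplus\cdots\oplus G_{m}$ denotes the corresponding join of finitely many functions (for $m=-1$ it is the empty oracle). Given $H,G:\omega\to\omega$, $H$ is $\mathsf{DNR}^G$ if for all $x$, $\Phi^G_x(x)$ diverges or $H(x)\ne\Phi^G_x(x)$; $H$ is $\mathsf{DNR}$ if it is $\mathsf{DNR}^\emptyset$; $H$ is $h$-$\mathsf{DNR}$ if it is $\mathsf{DNR}$ and $H(n)<h(n)$ for all $n$. A function $G:\omega\to\omega$ is called relatively $\mathsf{DNR}$ if there are no $x,y\in\omega$ with $G_{2y}(x)=\Phi_x^{G_0\oplus\cdots\oplus G_{2y-1}}(x)$ (for $y=0$ the oracle is empty). *)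

(* Defs.v *)
From mathcomp Require Import all_boot.

Set Implicit Arguments.
Unset Strict Implicit.
Unset Printing Implicit Defensive.

(* Kleene's mu-recursive schemata relative to an oracle [G : nat -> nat].
   Programs carry no arity; a missing argument of [Proj] reads as 0, and the
   other schemata diverge when they lack the argument they inspect. *)
Inductive code : Type :=
| Zero
| Succ
| Proj of nat
| Oracle
| Comp of code & seq code
| Rec of code & code
| Mu of code.

(* [eval G c xs y]: program [c] with oracle [G] halts on [xs] with output [y]. *)
Inductive eval (G : nat -> nat) : code -> seq nat -> nat -> Prop :=
| eval_Zero xs : eval G Zero xs 0
| eval_Succ x xs : eval G Succ (x :: xs) x.+1
| eval_Proj i xs : eval G (Proj i) xs (nth 0 xs i)
| eval_Oracle x xs : eval G Oracle (x :: xs) (G x)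
| eval_Comp f gs xs ys y :
    evals G gs xs ys -> eval G f ys y -> eval G (Comp f gs) xs y
| eval_Rec0 f g xs y :
    eval G f xs y -> eval G (Rec f g) (0 :: xs) y
| eval_RecS f g n xs r y :
    eval G (Rec f g) (n :: xs) r -> eval G g [:: n, r & xs] y ->
    eval G (Rec f g) (n.+1 :: xs) y
| eval_Mu f xs n (z : nat -> nat) :
    (forall m, m < n -> eval G f (m :: xs) (z m).+1) ->
    eval G f (n :: xs) 0 ->
    eval G (Mu f) xs n
with evals (G : nat -> nat) : seq code -> seq nat -> seq nat -> Prop :=
| evals_nil xs : evals G [::] xs [::]
| evals_cons g gs xs y ys :
    eval G g xs y -> evals G gs xs ys -> evals G (g :: gs) xs (y :: ys).

(* A partial functional is given by its graph: [F G x y] means F^G(x) = y. *)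
Definition functional := (nat -> nat) -> nat -> nat -> Prop.

Definition turing_functional (F : functional) : Prop :=
  exists c, forall G x y, F G x y <-> eval G c [:: x] y.

(* The characteristic function of the empty set. *)
Definition empty_oracle : nat -> nat := fun=> 0.

Definition recursive (f : nat -> nat) : Prop :=
  exists c, forall x, eval empty_oracle c [:: x] (f x).

(* "Standard" is read as acceptable in the sense of Rogers: there is a universal
   functional, and the s-m-n property holds. Applying the latter to programs
   that ignore their first argument, every Turing functional is some [Phi n]. *)
Definition standard_enumeration (Phi : nat -> functional) : Prop :=
  (exists u, forall e G x y, Phi e G x y <-> eval G u [:: e; x] y) /\
  (forall c, exists2 s, recursive s &
     forall e G x y, Phi (s e) G x y <-> eval G c [:: e; x] y).

Definition column (G : nat -> nat) (n : nat) : nat -> nat :=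
  fun k => G (2 ^ n * (2 * k).+1).

(* For p > 0, p = 2 ^ n * (2 * k + 1) with n = logn 2 p and
   k = (p %/ 2 ^ n)./2. The argument 0 lies in no column. *)
Definition oplus (F : nat -> nat -> nat) : nat -> nat :=
  fun p => if p == 0 then 0 else F (logn 2 p) (p %/ 2 ^ logn 2 p)./2.

Lemma column_oplus F n k : column (oplus F) n k = F n k.
Proof.
rewrite /column /oplus muln_eq0 expn_eq0 /=.
have -> : logn 2 (2 ^ n * (2 * k).+1) = n.
  rewrite lognM ?expn_gt0 // pfactorK // logn_coprime ?addn0 //.
  by rewrite coprime2n /= mul2n odd_double.
by rewrite mulKn ?expn_gt0 // mul2n -add1n halfD odd_double doubleK.
Qed.

(* The join of the first [m] columns, G_0 (+) ... (+) G_(m-1); the remaining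
   columns are 0, so that [join G 0] is the empty oracle. *)
Definition join (G : nat -> nat) (m : nat) : nat -> nat :=
  oplus (fun n => if n < m then column G n else empty_oracle).

Definition DNR_rel (Phi : nat -> functional) (G H : nat -> nat) : Prop :=
  forall x y, Phi x G x y -> H x <> y.

Definition DNR (Phi : nat -> functional) (H : nat -> nat) : Prop :=
  DNR_rel Phi empty_oracle H.

Definition bounded_DNR (Phi : nat -> functional) (h H : nat -> nat) : Prop :=
  DNR Phi H /\ forall n, H n < h n.

Definition relatively_DNR (Phi : nat -> functional) (G : nat -> nat) : Prop :=
  ~ exists x y, Phi x (join G (2 * y)) x (column G (2 * y) x).

(* Main.v *)
(** The columns are built one even column at a time (odd ones are 0), keeping
    the invariant that the oracle C built so far computes no h-DNR function.
    The next column g is obtained by forcing with bushy trees: a condition is a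
    finite string together with a set of bad strings that is not k-big above
    it, initially the strings that fail to be DNR relative to C, which are not
    2-big. To defeat a functional, look at the strings t forcing its value at x
    to be some i < h(x). If for some x these are not (h(x) k + 1)-big, declare
    them bad: then the value at x can no longer be below h(x). Otherwise, for
    every x, some single value i < h(x) is forced by a k-big set of strings, and
    searching for a finite tree witnessing this computes such an i from C. By
    the invariant this C-computable function of x is not DNR, so at some x it
    picks the value Phi_x(x), and by k-bigness a good string forces the
    functional to take that value. *)
Require Import Defs.
From mathcomp Require Import all_boot.
From Stdlib Require Import Classical ClassicalEpsilon FunctionalExtensionality.

Set Implicit Arguments.
Unset Strict Implicit.
Unset Printing Implicit Defensive.

(** * A bounded evaluator for partial oracles *)

(** The list inside [Comp] makes [code] a nested type, so its members need an explicit induction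
    hypothesis. It is indexed by position; the default [Zero] is covered by [hZ]. *)
Fixpoint code_nested_ind (K : code -> Prop) (hZ : K Zero) (hS : K Succ)
    (hP : forall i, K (Proj i)) (hO : K Oracle)
    (hC : forall f gs, K f -> (forall i, K (nth Zero gs i)) -> K (Comp f gs))
    (hR : forall f g, K f -> K g -> K (Rec f g))
    (hM : forall f, K f -> K (Mu f)) (c : code) {struct c} : K c :=
  let rec := code_nested_ind hZ hS hP hO hC hR hM in
  match c with
  | Zero => hZ
  | Succ => hS
  | Proj i => hP i
  | Oracle => hO
  | Comp f gs =>
    hC f gs (rec f)
      ((fix all_nth (gs : seq code) i : K (nth Zero gs i) :=
          match gs, i with
          | [::], 0 | [::], _.+1 => hZ
          | g :: _, 0 => rec g
          | _ :: gs', i'.+1 => all_nth gs' i'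
          end) gs)
  | Rec f g => hR f g (rec f) (rec g)
  | Mu f => hM f (rec f)
  end.

Scheme eval_mut := Minimality for eval Sort Prop
  with evals_mut := Minimality for evals Sort Prop.

(* A value [y.+1] of the partial oracle [P], or of [run], stands for the
   result [y], and 0 for "undefined"; the bound [s] only limits the
   unbounded searches. *)
Fixpoint run (P : nat -> nat) (s : nat) (c : code) (xs : seq nat) : nat :=
  match c with
  | Zero => 1
  | Succ => if xs is x :: _ then x.+2 else 0
  | Proj i => (nth 0 xs i).+1
  | Oracle => if xs is x :: _ then P x else 0
  | Comp f gs =>
    let ys := [seq run P s g xs | g <- gs] in
    if 0 \notin ys then run P s f (map predn ys) else 0
  | Rec f g =>
    if xs is n :: xs' then
      iteri n (fun m r => if r is r'.+1 then run P s g [:: m, r' & xs'] else 0)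
        (run P s f xs')
    else 0
  | Mu f =>
    let n := find (fun m => run P s f (m :: xs) <= 1) (iota 0 s) in
    if (n < s) && (run P s f (n :: xs) == 1) then n.+1 else 0
  end.

(** With 0 read as undefined, this is inclusion of graphs of partial functions. *)
Definition extends (P P' : nat -> nat) := forall x, P x != 0 -> P' x = P x.

Lemma map_run_mono (F F' : code -> nat) gs :
  (forall i, F (nth Zero gs i) != 0 ->
     F' (nth Zero gs i) = F (nth Zero gs i)) ->
  0 \notin map F gs -> map F' gs = map F gs.
Proof.
elim: gs => //= g gs IH H; rewrite inE negb_or eq_sym => /andP[Fg Fgs].
by rewrite (H 0 Fg) IH // => i; apply: (H i.+1).
Qed.

(** The search stops at the first result that is at most 1, that is, undefined or an encoded zero;
    the final test in [run] tells the two apart. *)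
Lemma run_MuE P s f xs n :
  run P s (Mu f) xs = n.+1 <->
  [/\ n < s, run P s f (n :: xs) = 1 & forall m, m < n -> 1 < run P s f (m :: xs)].
Proof.
rewrite /=; set p := fun m => _; set k := find _ _; split.
  case: ifP => // /andP[ks /eqP fk] [<-]; split=> // m mk.
  have /(before_find 0) := mk.
  by rewrite nth_iota ?(ltn_trans mk ks) // add0n /p leqNgt => /negbFE.
case=> ns fn fm; suff -> : k = n by rewrite ns fn.
rewrite /k -(subnKC ns) addSnnS iotaD add0n find_cat /= /p fn /= size_iota addn0.
by rewrite ifN //; apply/hasPn => m; rewrite mem_iota -ltnNge /= => /fm.
Qed.

(** A defined result comes from defined subcomputations only, and these survive any enlargement of
    the oracle or of the search bound. *)
Lemma run_mono P P' s s' c xs : extends P P' -> s <= s' ->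
  run P s c xs != 0 -> run P' s' c xs = run P s c xs.
Proof.
move=> PP' ss'; elim/code_nested_ind: c xs => //=.
- by case=> // x xs; apply: PP'.
- move=> f gs IHf IHgs xs; case: ifP => // gs0.
  have E := @map_run_mono (fun g => run P s g xs) (fun g => run P' s' g xs) gs
    (fun i => IHgs i xs) gs0.
  by rewrite E gs0; apply: IHf.
- move=> f g IHf IHg [|n xs] //.
  elim: n => [|n IHn] /=; first exact: IHf.
  set r := iteri n _ (run P s f xs) in IHn *.
  case: r IHn => //= r IHn; rewrite IHn //; exact: IHg.
- move=> f IHf xs; rewrite -/(run P s (Mu f) xs) -/(run P' s' (Mu f) xs).
  case E: (run P s (Mu f) xs) => [|n] // _.
  move/run_MuE: E => [ns fn fm]; apply/run_MuE; split.
  + exact: leq_trans ns ss'.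
  + by rewrite IHf fn.
  + by move=> m /fm fm1; rewrite IHf // -lt0n ltnW.
Qed.

Lemma map_run_sound G (F : code -> nat) xs gs :
  (forall i y, F (nth Zero gs i) = y.+1 -> eval G (nth Zero gs i) xs y) ->
  0 \notin map F gs -> evals G gs xs (map predn (map F gs)).
Proof.
elim: gs => [|g gs IH] H; first by constructor.
rewrite inE negb_or eq_sym -lt0n => /andP[Fg Fgs] /=.
constructor; first by apply: (H 0); rewrite /= prednK.
by apply: IH => // i; apply: (H i.+1).
Qed.

Lemma run_sound G P s c xs y :
  extends P (succn \o G) -> run P s c xs = y.+1 -> eval G c xs y.
Proof.
move=> PG; elim/code_nested_ind: c xs y.
- by move=> xs y [<-]; constructor.
- by case=> // x xs y [<-]; constructor.
- by move=> i xs y [<-]; constructor.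
- case=> // x xs y /= Px; have := PG x.
  by rewrite Px => /(_ isT) [<-]; constructor.
- move=> f gs IHf IHgs xs y /=; case: ifP => // gs0 /IHf fy.
  by apply: eval_Comp fy; apply: map_run_sound gs0 => i z; apply: IHgs.
- move=> f g IHf IHg [|n xs] y //=.
  elim: n y => [|n IHn] y /=; first by move/IHf; constructor.
  case: (iteri n _ _) IHn => // r IHn /IHg gy.
  by apply: eval_RecS gy; apply: IHn.
- move=> f IHf xs n /run_MuE[_ fn fm].
  (* Results above 1 encode positive values: one predecessor undoes the encoding, the other yields
     the [z m] of [eval_Mu]. *)
  apply: (eval_Mu (z := fun m => (run P s f (m :: xs)).-2)); last exact: IHf.
  by move=> m /fm fm1; apply: IHf; case: (run _ _ _ _) fm1 => [|[]].
Qed.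

(** A halting computation is finite, so one bound [s0] exceeds all its oracle queries and search
    results. *)
Lemma run_complete G c xs y : eval G c xs y ->
  exists s0, forall s P, s0 <= s -> (forall x, x < s0 -> P x = (G x).+1) ->
    run P s c xs = y.+1.
Proof.
move: c xs y; apply: (@eval_mut G (fun c xs y => exists s0, forall s P,
    s0 <= s -> (forall x, x < s0 -> P x = (G x).+1) -> run P s c xs = y.+1)
  (fun gs xs ys => exists s0, forall s P,
    s0 <= s -> (forall x, x < s0 -> P x = (G x).+1) ->
    [seq run P s g xs | g <- gs] = map succn ys)).
- by move=> xs; exists 0.
- by move=> x xs; exists 0.
- by move=> i xs; exists 0.
- by move=> x xs; exists x.+1 => s P _ H; apply: H.
- move=> f gs xs ys y _ [a Ha] _ [b Hb]; exists (maxn a b) => s P.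
  rewrite geq_max => /andP[sa sb] H /=.
  rewrite Ha // => [|x xa]; last by rewrite H // leq_max xa.
  rewrite ifT; last by apply/mapP=> -[].
  rewrite -map_comp map_id_in // Hb // => x xb.
  by rewrite H // leq_max xb orbT.
- by move=> f g xs y _ [a Ha]; exists a => s P sa H; apply: Ha.
- move=> f g n xs r y _ [a Ha] _ [b Hb]; exists (maxn a b) => s P.
  rewrite geq_max => /andP[sa sb] H /=.
  have /= -> := Ha s P sa; last by move=> x xa; rewrite H // leq_max xa.
  by apply: Hb => // x xb; rewrite H // leq_max xb orbT.
- move=> f xs n z _ IHz _ [b Hb].
  (* The finitely many bounds for [m < n] are merged into one maximum. *)
  have [a Ha] : exists a, forall s P, a <= s ->
      (forall x, x < a -> P x = (G x).+1) ->
      forall m, m < n -> run P s f (m :: xs) = (z m).+2.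
    elim: n IHz {Hb} => [|n IHn] IHz; first by exists 0.
    have [a Ha] := IHn (fun m mn => IHz m (ltnW mn)).
    have [a' Ha'] := IHz n (ltnSn n).
    exists (maxn a a') => s P; rewrite geq_max => /andP[sa sa'] H m.
    rewrite ltnS leq_eqVlt => /orP[/eqP ->|mn].
      by apply: Ha' => // x xa; rewrite H // leq_max xa orbT.
    by apply: Ha mn => // x xa; rewrite H // leq_max xa.
  exists (maxn n.+1 (maxn a b)) => s P.
  rewrite !geq_max => /and3P[ns sa sb] H; apply/run_MuE; split=> //.
    by apply: Hb => // x xb; rewrite H // !leq_max xb !orbT.
  by move=> m mn; rewrite (Ha s P sa) // => x xa; rewrite H // !leq_max xa orbT.
- by move=> xs; exists 0.
- move=> g gs xs y ys _ [a Ha] _ [b Hb]; exists (maxn a b) => s P.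
  rewrite geq_max => /andP[sa sb] H /=.
  rewrite Ha // => [|x xa]; last by rewrite H // leq_max xa.
  by rewrite Hb // => x xb; rewrite H // leq_max xb orbT.
Qed.

(** Both derivations are reproduced by [run] at a common bound, and [run] is a function. *)
Lemma eval_functional G c xs y y' : eval G c xs y -> eval G c xs y' -> y = y'.
Proof.
move=> /run_complete[a Ha] /run_complete[b Hb].
pose P x := (G x).+1.
have := Ha (maxn a b) P (leq_maxl a b) (fun _ _ => erefl).
by rewrite (Hb _ _ (leq_maxr a b) (fun _ _ => erefl)) => -[].
Qed.
(** * Closure properties of the computable functions *)

(** An [l]-ary function is written over an infinite environment [r], of which the program sees the
    first [l] entries. Predicates are included through the coercion of Booleans to numbers. *)
Definition computable (G : nat -> nat) (l : nat) (f : (nat -> nat) -> nat) :=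
  exists c, forall r, eval G c (mkseq r l) (f r).

Definition scons (x : nat) (r : nat -> nat) : nat -> nat :=
  fun i => if i is i'.+1 then r i' else x.

Lemma mkseqS (T : Type) (r : nat -> T) l :
  mkseq r l.+1 = r 0 :: mkseq (fun i => r i.+1) l.
Proof. by rewrite /mkseq /= -add1n iotaDl -map_comp. Qed.

Lemma evals_mkseq G (gs : seq code) xs (ys : nat -> nat) :
  (forall i, i < size gs -> eval G (nth Zero gs i) xs (ys i)) ->
  evals G gs xs (mkseq ys (size gs)).
Proof.
elim: gs ys => [|g gs IH] ys H; first by constructor.
rewrite [size _]/= mkseqS; constructor; first exact: (H 0).
by apply: IH => i; apply: (H i.+1).
Qed.

Section Computable.
Variable G : nat -> nat.
Notation computable := (computable G).

Lemma computable_ext l f g : f =1 g -> computable l f -> computable l g.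
Proof. by move=> fg [c Hc]; exists c => r; rewrite -fg. Qed.

Lemma computable_var l i : i < l -> computable l (fun r => r i).
Proof.
by move=> il; exists (Proj i) => r; rewrite -[r i](nth_mkseq 0 r il); constructor.
Qed.

(** Closure under composition; taking variables for the [g i] also gives renaming and permutation of
    arguments. *)
Lemma computable_subst k l (F : (nat -> nat) -> nat)
    (g : nat -> (nat -> nat) -> nat) :
  computable k F -> (forall i, i < k -> computable l (g i)) ->
  computable l (fun r => F (fun i => g i r)).
Proof.
move=> [c Hc] Hg.
have [gs [sgs Hgs]] : exists gs, size gs = k /\
    forall i r, i < k -> eval G (nth Zero gs i) (mkseq r l) (g i r).
  elim: k Hg {c Hc} => [|k IHk] Hg; first by exists [::].
  have [gs [sgs Hgs]] := IHk (fun i ik => Hg i (ltnW ik)).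
  have [c Hc] := Hg k (ltnSn k).
  exists (rcons gs c); rewrite size_rcons sgs; split=> // i r.
  rewrite ltnS leq_eqVlt nth_rcons sgs => /orP[/eqP ->|ik].
    by rewrite ltnn eqxx.
  by rewrite ik; apply: Hgs.
exists (Comp c gs) => r; apply: eval_Comp (Hc _).
by rewrite -sgs; apply: evals_mkseq => i; rewrite sgs => /Hgs.
Qed.

Lemma computable_Succ l f : computable l f -> computable l (fun r => (f r).+1).
Proof.
by move=> [c Hc]; exists (Comp Succ [:: c]) => r;
  apply: eval_Comp (eval_Succ _ _ _); constructor; [apply: Hc | constructor].
Qed.

Lemma computable_const l n : computable l (fun=> n).
Proof.
elim: n => [|n IHn]; last exact: computable_Succ.
by exists Zero => r; constructor.
Qed.

Lemma computable_oracle l f : computable l f -> computable l (fun r => G (f r)).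
Proof.
by move=> [c Hc]; exists (Comp Oracle [:: c]) => r;
  apply: eval_Comp (eval_Oracle _ _ _); constructor; [apply: Hc | constructor].
Qed.

(** Primitive recursion: in the step function, variables 0 and 1 hold the counter and the
    accumulator, and the parameters are shifted by two. *)
Lemma computable_iteri l (st : nat -> nat -> (nat -> nat) -> nat) f n :
  computable l.+2 (fun r => st (r 0) (r 1) (fun i => r i.+2)) ->
  computable l f -> computable l n ->
  computable l (fun r => iteri (n r) (fun m y => st m y r) (f r)).
Proof.
move=> [cs Hs] [cf Hf] [cn Hn].
exists (Comp (Rec cf cs) (cn :: mkseq Proj l)) => r.
apply: (@eval_Comp _ _ _ _ (n r :: mkseq r l)).
  constructor=> //; have /= := @evals_mkseq G (mkseq Proj l) (mkseq r l) r.
  rewrite size_mkseq; apply=> i il.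
  by rewrite nth_mkseq // -[r i](nth_mkseq 0 r il); constructor.
elim: (n r) => [|m IHm]; first by constructor.
apply: eval_RecS IHm _ => /=.
by have := Hs (scons m (scons (iteri m (fun m y => st m y r) (f r)) r));
  rewrite !mkseqS.
Qed.

Lemma computable_least l (p : nat -> (nat -> nat) -> bool)
    (ex : forall r, exists m, p m r) :
  computable l.+1 (fun r => p (r 0) (fun i => r i.+1)) ->
  computable l (fun r => ex_minn (ex r)).
Proof.
move=> Hp.
(* [iteri b (fun _ _ => 0) 1] is the numerical negation of [b]; [Mu] searches for its first zero. *)
have [c Hc] : computable l.+1 (fun r => iteri (p (r 0) (fun i => r i.+1))
    (fun _ _ => 0) 1).
  apply: (@computable_iteri _ (fun _ _ _ => 0)) => //; exact: computable_const.
exists (Mu c) => r; case: ex_minnP => n pn min_n.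
have Hcm m : eval G c (m :: mkseq r l) (iteri (p m r) (fun _ _ => 0) 1).
  by have := Hc (scons m r); rewrite mkseqS.
apply: (eval_Mu (z := fun=> 0)); last by have := Hcm n; rewrite pn.
move=> m mn; have := Hcm m; case: (boolP (p m r)) => // /min_n.
by rewrite leqNgt mn.
Qed.

(** An unbounded search for the value turns a decidable graph into a program. *)
Lemma computable_graph l f :
  computable l.+1 (fun r => r 0 == f (fun i => r i.+1)) -> computable l f.
Proof.
move=> H; have ex r : exists m, m == f r by exists (f r).
apply: computable_ext (@computable_least l (fun m r => m == f r) ex H) => r.
by case: ex_minnP => m /eqP.
Qed.

Lemma computable_comp1 l (op : nat -> nat) f :
  computable 1 (fun r => op (r 0)) -> computable l f ->
  computable l (fun r => op (f r)).
Proof. by move=> Hop Hf; apply: (computable_subst (g := fun=> f) Hop). Qed.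

Lemma computable_comp2 l (op : nat -> nat -> nat) f g :
  computable 2 (fun r => op (r 0) (r 1)) -> computable l f -> computable l g ->
  computable l (fun r => op (f r) (g r)).
Proof.
move=> Hop Hf Hg.
by apply: (computable_subst (g := fun i => if i is 0 then f else g) Hop) => -[].
Qed.

Lemma computable_add l f g : computable l f -> computable l g ->
  computable l (fun r => f r + g r).
Proof.
move=> Hf Hg.
apply: computable_ext (@computable_iteri l (fun _ y _ => y.+1) g f _ Hg Hf).
  by move=> r; elim: (f r) => //= n ->.
exact/computable_Succ/computable_var.
Qed.

Lemma computable_mul l f g : computable l f -> computable l g ->
  computable l (fun r => f r * g r).
Proof.
move=> Hf Hg; apply: (@computable_comp2 l muln) => //.
apply: computable_ext (@computable_iteri 2 (fun _ y r => r 1 + y) (fun=> 0)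
  (fun r => r 0) _ _ _).
- by move=> r; elim: (r 0) => //= n ->; rewrite mulSn.
- by apply: computable_add; apply: computable_var.
- exact: computable_const.
- exact: computable_var.
Qed.

Lemma computable_exp2 l f : computable l f -> computable l (fun r => 2 ^ f r).
Proof.
move=> Hf.
apply: computable_ext (@computable_iteri l (fun _ y _ => 2 * y) (fun=> 1) f _ _ Hf).
- by move=> r; elim: (f r) => //= n ->; rewrite expnS.
- by apply: computable_mul; [apply: computable_const | apply: computable_var].
- exact: computable_const.
Qed.

Lemma computable_pred l f : computable l f -> computable l (fun r => (f r).-1).
Proof.
move=> Hf.
apply: computable_ext (@computable_iteri l (fun m _ _ => m) (fun=> 0) f _ _ Hf).
- by move=> r; case: (f r).
- exact: computable_var.
- exact: computable_const.
Qed.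

Lemma computable_sub l f g : computable l f -> computable l g ->
  computable l (fun r => f r - g r).
Proof.
move=> Hf Hg.
apply: computable_ext (@computable_iteri l (fun _ y _ => y.-1) f g _ Hf Hg).
  by move=> r; elim: (g r) => /= [|n ->]; rewrite ?subn0 ?subnS.
exact/computable_pred/computable_var.
Qed.

Lemma computable_if l (b : (nat -> nat) -> bool) f g :
  computable l b -> computable l f -> computable l g ->
  computable l (fun r => if b r then f r else g r).
Proof.
move=> Hb Hf Hg.
apply: (@computable_ext _ (fun r => b r * f r + (1 - b r) * g r)).
  by move=> r; case: (b r); rewrite ?mul0n ?mul1n ?addn0.
apply: computable_add; apply: computable_mul => //.
by apply: computable_sub => //; apply: computable_const.
Qed.

Lemma computable_eq0 l f : computable l f -> computable l (fun r => f r == 0).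
Proof.
move=> Hf; apply: computable_ext
  (computable_sub (computable_const l 1) Hf) => r.
by case: (f r).
Qed.

Lemma computable_neg l (b : (nat -> nat) -> bool) :
  computable l b -> computable l (fun r => ~~ b r).
Proof.
by move=> /computable_eq0; apply: computable_ext => r; case: (b r).
Qed.

Lemma computable_leq l f g : computable l f -> computable l g ->
  computable l (fun r => f r <= g r).
Proof. by move=> Hf Hg; apply: computable_eq0; apply: computable_sub. Qed.

Lemma computable_and l (a b : (nat -> nat) -> bool) :
  computable l a -> computable l b -> computable l (fun r => a r && b r).
Proof.
move=> Ha Hb; apply: computable_ext (computable_mul Ha Hb) => r.
by rewrite mulnb.
Qed.

Lemma computable_or l (a b : (nat -> nat) -> bool) :
  computable l a -> computable l b -> computable l (fun r => a r || b r).
Proof.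
move=> Ha Hb; apply: (@computable_ext _ (fun r => if a r then 1 else b r)).
  by move=> r; case: (a r).
by apply: computable_if => //; apply: computable_const.
Qed.

Lemma computable_eq l f g : computable l f -> computable l g ->
  computable l (fun r => f r == g r).
Proof.
move=> Hf Hg; apply: (@computable_ext _ (fun r => (f r <= g r) && (g r <= f r))).
  by move=> r; rewrite eqn_leq.
by apply: computable_and; apply: computable_leq.
Qed.

Lemma computable_count l (p : nat -> (nat -> nat) -> bool) n :
  computable l.+1 (fun r => p (r 0) (fun i => r i.+1)) -> computable l n ->
  computable l (fun r => count (p^~ r) (iota 0 (n r))).
Proof.
move=> Hp Hn; apply: computable_ext (@computable_iteri l
  (fun m y r => p m r + y) (fun=> 0) n _ _ Hn).
- move=> r; elim: (n r) => // m IHm.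
  by rewrite -[in RHS]addn1 iotaD count_cat -IHm /= addn0 addnC.
- apply: computable_add; last exact: computable_var.
  (* The accumulator occupies variable 1, so the parameters of [p] have to skip it. *)
  apply: (@computable_subst _ _ _ (fun i => if i is i'.+1 then
    fun r => r i'.+2 else fun r => r 0) Hp) => -[|i] il; exact: computable_var.
- exact: computable_const.
Qed.

Lemma computable_has l (p : nat -> (nat -> nat) -> bool) n :
  computable l.+1 (fun r => p (r 0) (fun i => r i.+1)) -> computable l n ->
  computable l (fun r => has (p^~ r) (iota 0 (n r))).
Proof.
move=> Hp Hn; apply: (@computable_ext _ (fun r =>
  0 < count (p^~ r) (iota 0 (n r)))).
  by move=> r; rewrite has_count.
apply: computable_leq; [exact: computable_const | exact: computable_count].
Qed.

Lemma computable_all l (p : nat -> (nat -> nat) -> bool) n :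
  computable l.+1 (fun r => p (r 0) (fun i => r i.+1)) -> computable l n ->
  computable l (fun r => all (p^~ r) (iota 0 (n r))).
Proof.
move=> Hp Hn; apply: (@computable_ext _ (fun r =>
  ~~ has (fun m => ~~ p m r) (iota 0 (n r)))).
  by move=> r; rewrite has_predC negbK.
apply: computable_neg; apply: (@computable_has _ (fun m r => ~~ p m r)) => //.
exact: computable_neg.
Qed.

(** Since [find] returns the length [n] on failure, its result is the least [m] that equals [n] or
    satisfies [p]. *)
Lemma computable_find l (p : nat -> (nat -> nat) -> bool) n :
  computable l.+1 (fun r => p (r 0) (fun i => r i.+1)) -> computable l n ->
  computable l (fun r => find (p^~ r) (iota 0 (n r))).
Proof.
move=> Hp Hn.
have ex r : exists m, (m == n r) || p m r by exists (n r); rewrite eqxx.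
apply: computable_ext (@computable_least l (fun m r => (m == n r) || p m r) ex _).
  move=> r; case: ex_minnP => m pm min_m; symmetry.
  have mn : m <= n r by apply: min_m; rewrite eqxx.
  rewrite -(subnKC mn) iotaD find_cat size_iota add0n ifN; last first.
    apply/hasPn => j; rewrite mem_iota add0n => /= jm.
    by apply: contraL jm => pj; rewrite -leqNgt min_m // pj orbT.
  have [->|] := eqVneq m (n r); first by rewrite subnn addn0.
  move=> m_neq; rewrite (negPf m_neq) /= in pm.
  have : 0 < n r - m by rewrite subn_gt0 ltn_neqAle m_neq.
  by case: (n r - m) => //= k _; rewrite pm addn0.
apply: computable_or => //; apply: computable_eq; first exact: computable_var.
apply: (@computable_subst _ _ _ (fun i r => r i.+1) Hn) => i il.
exact: computable_var.
Qed.

End Computable.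

(** * Computability of the bounded evaluator *)

(** The program [c] is fixed, so the recursion on it takes place outside the object language and no
    universal program is built. Variable 0 is the search bound, variable 1 the index of a partial
    oracle, the rest are arguments. *)
Lemma run_computable G (P : nat -> nat -> nat) c l :
  computable G 2 (fun r => P (r 0) (r 1)) ->
  computable G l.+2 (fun r =>
    run (P (r 1)) (r 0) c (mkseq (fun i => r i.+2) l)).
Proof.
move=> HP; elim/code_nested_ind: c l.
- by move=> l; apply: computable_const.
- case=> [|l]; first exact: computable_const.
  by do 2!apply: computable_Succ; apply: computable_var.
- move=> i l; apply: computable_Succ.
  have [il|li] := ltnP i l; last first.
    apply: computable_ext (computable_const _ _ 0) => r.
    by rewrite nth_default ?size_mkseq.
  apply: (@computable_ext _ _ (fun r => r i.+2)) => [r|].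
    by rewrite nth_mkseq.
  exact: computable_var.
- case=> [|l]; first exact: computable_const.
  by apply: computable_comp2 => //; apply: computable_var.
- move=> f gs IHf IHgs l.
  pose R g r := run (P (r 1)) (r 0) g (mkseq (fun i => r i.+2) l).
  apply: (@computable_ext _ _ (fun r => if 0 \notin [seq R g r | g <- gs] then
    run (P (r 1)) (r 0) f (mkseq (fun i => (R (nth Zero gs i) r).-1) (size gs))
    else 0)).
    move=> r /=; congr (if _ then run _ _ f _ else _).
    rewrite -map_comp; apply: (@eq_from_nth _ 0) => [|i].
      by rewrite size_mkseq size_map.
    by rewrite size_mkseq => igs; rewrite nth_mkseq // (nth_map Zero).
  apply: computable_if; last exact: computable_const.
  + elim: gs {IHf} IHgs => [|g gs IH] IHgs; first exact: computable_const.
    apply: (@computable_ext _ _ (fun r =>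
      ~~ (R g r == 0) && (0 \notin [seq R g' r | g' <- gs]))).
      by move=> r; rewrite [map _ _]/= inE negb_or (eq_sym 0).
    apply: computable_and; last by apply: IH => i; apply: (IHgs i.+1).
    exact/computable_neg/computable_eq0/(IHgs 0).
  + apply: (computable_subst (g := fun i r =>
      if i is i'.+2 then (R (nth Zero gs i') r).-1 else r i) (IHf (size gs))).
    case=> [|[|i]] _; try exact: computable_var.
    exact/computable_pred/IHgs.
- move=> f g IHf IHg [|l]; first exact: computable_const.
  apply: (@computable_ext _ _ (fun r => iteri (r 2) (fun m y =>
      if y == 0 then 0 else
      run (P (r 1)) (r 0) g (m :: y.-1 :: mkseq (fun i => r i.+3) l))
    (run (P (r 1)) (r 0) f (mkseq (fun i => r i.+3) l)))).
    by move=> r; rewrite mkseqS /=; apply: eq_iteri => m [].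
  apply: (@computable_iteri _ _ (fun m y r => if y == 0 then 0 else
      run (P (r 1)) (r 0) g (m :: y.-1 :: mkseq (fun i => r i.+3) l))).
  + apply: computable_if; [|exact: computable_const|].
      exact/computable_eq0/computable_var.
    apply: (@computable_ext _ _ (fun r => run (P (r 3)) (r 2) g
      (mkseq (fun i => match i with
        | 0 => r 0 | 1 => (r 1).-1 | i'.+2 => r i'.+4.+1 end) l.+2))).
      by move=> r; rewrite !mkseqS.
    (* Counter and encoded accumulator come first here, then bound and oracle index; variable 4 is
       the recursion argument, which [g] does not receive. *)
    apply: (computable_subst (g := fun i r => match i with
      | 0 => r 2 | 1 => r 3 | 2 => r 0 | 3 => (r 1).-1 | i'.+4 => r i'.+4.+1 end)
      (IHg l.+2)).
    case=> [|[|[|[|i]]]] il; try exact: computable_var.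
    exact/computable_pred/computable_var.
  + apply: (computable_subst (g := fun i r => if i is i'.+2 then r i'.+3 else r i)
      (IHf l)).
    by case=> [|[|i]] il; apply: computable_var.
  + exact: computable_var.
- move=> f IHf l.
  pose F m r := run (P (r 1)) (r 0) f (m :: mkseq (fun i => r i.+2) l).
  pose find_F r := find (fun m => F m r <= 1) (iota 0 (r 0)).
  have compF m : computable G l.+2 m -> computable G l.+2 (fun r => F (m r) r).
    move=> Hm; apply: (@computable_ext _ _ (fun r => run (P (r 1)) (r 0) f
      (mkseq (fun i => if i is i'.+1 then r i'.+2 else m r) l.+1))).
      by move=> r; rewrite mkseqS.
    apply: (computable_subst (g := fun i r => match i with
      | 0 => r 0 | 1 => r 1 | 2 => m r | i'.+3 => r i'.+2 end) (IHf l.+1)).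
    by case=> [|[|[|i]]] il //; apply: computable_var.
  have comp_find : computable G l.+2 find_F.
    apply: (@computable_find _ _ (fun m r => F m r <= 1)); last first.
      exact: computable_var.
    apply: computable_leq; last exact: computable_const.
    apply: (@computable_ext _ _ (fun r => run (P (r 2)) (r 1) f
      (mkseq (fun i => if i is i'.+1 then r i'.+3 else r 0) l.+1))).
      by move=> r; rewrite mkseqS.
    apply: (computable_subst (g := fun i r => match i with
      | 0 => r 1 | 1 => r 2 | 2 => r 0 | i'.+3 => r i'.+3 end) (IHf l.+1)).
    by case=> [|[|[|i]]] il //; apply: computable_var.
  apply: (@computable_ext _ _ (fun r => if (find_F r < r 0) &&
    (F (find_F r) r == 1) then (find_F r).+1 else 0)); first by [].
  apply: computable_if; [|exact: computable_Succ|exact: computable_const].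
  apply: computable_and; last first.
    by apply: computable_eq (computable_const _ _ 1); apply: compF.
  apply: computable_leq; [exact: computable_Succ | exact: computable_var].
Qed.
(** * Coding of finite sequences *)

(** This number is the position of entry [k] in column [n] and also the code of the list with head
    [n] and tail coded by [k]: one pairing serves both columns and strings. *)
Definition pair (n k : nat) : nat := 2 ^ n * (2 * k).+1.
Definition hd (x : nat) : nat := head 0 (CodeSeq.decode x).
Definition tl (x : nat) : nat := CodeSeq.code (behead (CodeSeq.decode x)).

Lemma pair_code n k : pair n k = CodeSeq.code (n :: CodeSeq.decode k).
Proof. by rewrite /= CodeSeq.decodeK /pair mul2n. Qed.

Lemma decode_pair n k : CodeSeq.decode (pair n k) = n :: CodeSeq.decode k.
Proof. by rewrite pair_code CodeSeq.codeK. Qed.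

Lemma hd_pair n k : hd (pair n k) = n.
Proof. by rewrite /hd decode_pair. Qed.

Lemma tl_pair n k : tl (pair n k) = k.
Proof. by rewrite /tl decode_pair CodeSeq.decodeK. Qed.

Lemma pair_neq0 n k : pair n k != 0.
Proof. by rewrite muln_eq0 expn_eq0. Qed.

Lemma pair_hd_tl x : x != 0 -> pair (hd x) (tl x) = x.
Proof.
move=> x0; rewrite pair_code /hd /tl CodeSeq.codeK.
case E: (CodeSeq.decode x) => [|n s]; last by rewrite -[RHS]CodeSeq.decodeK E.
by rewrite -(CodeSeq.decodeK x) E in x0.
Qed.

Lemma ltn_pairr n k : k < pair n k.
Proof.
apply: (@leq_trans (2 * k).+1); first by rewrite ltnS leq_pmull.
by rewrite /pair leq_pmull // expn_gt0.
Qed.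

Lemma tl_leq x : tl x <= x.
Proof.
have [->|x0] := eqVneq x 0; first by [].
by rewrite -[leqRHS](pair_hd_tl x0) ltnW // ltn_pairr.
Qed.

Lemma iter_tl m t : iter m tl t = CodeSeq.code (drop m (CodeSeq.decode t)).
Proof.
elim: m => [|m IHm] /=; first by rewrite drop0 CodeSeq.decodeK.
by rewrite IHm /tl CodeSeq.codeK -drop1 drop_drop.
Qed.

Lemma iter_tl_eq0 m t : (iter m tl t == 0) = (size (CodeSeq.decode t) <= m).
Proof.
rewrite iter_tl -subn_eq0 -size_drop size_eq0.
apply/eqP/eqP=> [E|-> //].
by rewrite -[LHS]CodeSeq.codeK E.
Qed.

Lemma hd_iter_tl m t : hd (iter m tl t) = nth 0 (CodeSeq.decode t) m.
Proof. by rewrite iter_tl /hd CodeSeq.codeK -nth0 nth_drop addn0. Qed.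

Lemma size_decode t : size (CodeSeq.decode t) <= t.
Proof.
rewrite -{2}(CodeSeq.decodeK t); elim: (CodeSeq.decode t) => // n s IHs.
rewrite -(CodeSeq.codeK s) -pair_code CodeSeq.codeK.
exact: leq_ltn_trans IHs (ltn_pairr _ _).
Qed.

(** A bounded search through the iterated tails makes membership computable; [d] bounds the length
    of the list it codes. *)
Lemma mem_decode t d : (t \in CodeSeq.decode d) =
  has (fun m => (iter m tl d != 0) && (hd (iter m tl d) == t)) (iota 0 d).
Proof.
apply/idP/hasP => [td|[m _]].
  exists (index t (CodeSeq.decode d)).
    by rewrite mem_iota add0n (leq_trans _ (size_decode d)) ?index_mem.
  by rewrite iter_tl_eq0 -ltnNge index_mem td hd_iter_tl nth_index ?eqxx.
by rewrite iter_tl_eq0 -ltnNge hd_iter_tl => /andP[md /eqP <-]; apply: mem_nth.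
Qed.

(** * Computability of the sequence coding *)

Section ComputableCoding.
Variable G : nat -> nat.
Notation computable := (computable G).

Lemma computable_pair l f g : computable l f -> computable l g ->
  computable l (fun r => pair (f r) (g r)).
Proof.
move=> Hf Hg; apply: computable_mul; first exact: computable_exp2.
by apply/computable_Succ/computable_mul => //; apply: computable_const.
Qed.

(** The graph is decidable by searching for a tail below the code; the code 0 of the empty list is
    treated apart. *)
Lemma computable_hd l f : computable l f -> computable l (fun r => hd (f r)).
Proof.
move=> Hf; apply: (@computable_comp1 _ _ hd) => // {f Hf}.
apply: computable_graph; apply: (@computable_ext _ _ (fun r => if r 1 == 0 then
  r 0 == 0 : nat else has (fun k => r 1 == pair (r 0) k) (iota 0 (r 1)))).
  move=> r; case: eqVneq => [->|r1] //; congr nat_of_bool.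
  apply/hasP/eqP => [[k _ /eqP ->]|E]; first by rewrite hd_pair.
  exists (tl (r 1)); last by rewrite E pair_hd_tl.
  by rewrite mem_iota -[X in _ < X](pair_hd_tl r1) ltn_pairr.
apply: computable_if; try by apply: computable_eq0; apply: computable_var.
apply: (@computable_has _ _ (fun k r => r 1 == pair (r 0) k)) => //.
  by apply: computable_eq; last apply: computable_pair; apply: computable_var.
exact: computable_var.
Qed.

Lemma computable_tl l f : computable l f -> computable l (fun r => tl (f r)).
Proof.
move=> Hf; apply: (@computable_comp1 _ _ tl) => // {f Hf}.
apply: computable_graph; apply: (@computable_ext _ _ (fun r => if r 1 == 0 then
  r 0 == 0 : nat else pair (hd (r 1)) (r 0) == r 1)).
  move=> r; case: eqVneq => [->|r1] //; congr nat_of_bool.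
  rewrite -{2}(pair_hd_tl r1); apply/eqP/eqP => [|-> //].
  by move/(congr1 tl); rewrite !tl_pair.
apply: computable_if; try by apply: computable_eq0; apply: computable_var.
apply: computable_eq; last exact: computable_var.
apply: computable_pair; last exact: computable_var.
exact/computable_hd/computable_var.
Qed.

Lemma computable_iter_tl l f g : computable l f -> computable l g ->
  computable l (fun r => iter (f r) tl (g r)).
Proof.
move=> Hf Hg.
apply: (@computable_iteri _ _ (fun _ y _ => tl y)) => //.
exact/computable_tl/computable_var.
Qed.

Lemma computable_mem_decode l f g : computable l f -> computable l g ->
  computable l (fun r => f r \in CodeSeq.decode (g r)).
Proof.
move=> Hf Hg.
apply: (@computable_comp2 _ _ (fun t d => t \in CodeSeq.decode d)) => //.
apply: computable_ext => [r|]; first by rewrite mem_decode; reflexivity.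
apply: (@computable_has _ _ (fun m r =>
  (iter m tl (r 1) != 0) && (hd (iter m tl (r 1)) == r 0))).
  have H : computable 3 (fun r => iter (r 0) tl (r 2)).
    by apply: computable_iter_tl; apply: computable_var.
  apply: computable_and; first exact/computable_neg/computable_eq0.
  by apply: computable_eq (computable_var _ _); first exact: computable_hd.
exact: computable_var.
Qed.

(** The length is the least number of tails that leads to the code 0. *)
Lemma computable_size_decode l f : computable l f ->
  computable l (fun r => size (CodeSeq.decode (f r))).
Proof.
move=> Hf; apply: (@computable_comp1 _ _ (size \o CodeSeq.decode)) => //= {f Hf}.
apply: computable_graph; apply: (@computable_ext _ _ (fun r =>
  (iter (r 0) tl (r 1) == 0) &&
  ((r 0 == 0) || (iter (r 0).-1 tl (r 1) != 0)))).
  move=> r; rewrite !iter_tl_eq0 -ltnNge; congr nat_of_bool.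
  by rewrite [RHS]eqn_leq [LHS]andbC; case: (r 0).
apply: computable_and.
  by apply/computable_eq0/computable_iter_tl; apply: computable_var.
apply: computable_or; first exact/computable_eq0/computable_var.
apply/computable_neg/computable_eq0/computable_iter_tl; last exact: computable_var.
exact/computable_pred/computable_var.
Qed.

(** Strings are coded in reverse, so positions are counted from the end. The successor and the
    default 0 match the encoding of partial oracles. *)
Lemma computable_lookup l f g : computable l f -> computable l g ->
  computable l (fun r => nth 0 (map succn (rev (CodeSeq.decode (f r)))) (g r)).
Proof.
move=> Hf Hg; apply: (@computable_ext _ _ (fun r =>
  if g r < size (CodeSeq.decode (f r)) then
    (hd (iter (size (CodeSeq.decode (f r)) - (g r).+1) tl (f r))).+1 else 0)).
  move=> r; case: ltnP => [gs|sg].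
    by rewrite hd_iter_tl (nth_map 0) ?size_rev // nth_rev.
  by rewrite nth_default // size_map size_rev.
have Hs := computable_size_decode Hf.
apply: computable_if; [|apply: computable_Succ|exact: computable_const].
  by apply: computable_leq => //; apply: computable_Succ.
apply/computable_hd/computable_iter_tl => //; apply: computable_sub => //.
exact: computable_Succ.
Qed.

End ComputableCoding.
(** * Bushy trees *)

(** A derivation is a finite tree above [s] whose leaves lie in [A] and whose inner nodes have at
    least [k] children. *)
Inductive big (k : nat) (A : seq nat -> Prop) : seq nat -> Prop :=
| big_leaf s : A s -> big k A s
| big_node s (l : seq nat) : uniq l -> k <= size l ->
    (forall a, a \in l -> big k A (rcons s a)) -> big k A s.

Lemma big_sub k A B s : (forall t, A t -> B t) -> big k A s -> big k B s.
Proof.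
move=> AB; elim=> {s} s => [/AB|l ul kl _ IH]; first exact: big_leaf.
exact: big_node IH.
Qed.

(** Label each child by the alternative that holds above it: if fewer than [a] children get the
    first label, at least [b] get the second. *)
Lemma big_union a b A B s :
  big (a + b) (fun t => A t \/ B t) s -> big a A s \/ big b B s.
Proof.
elim=> {s} s => [[As|Bs]|l ul kl _ IH]; [by left; left | by right; left | ].
pose p x : bool := excluded_middle_informative (big a A (rcons s x)).
have pP x : reflect (big a A (rcons s x)) (p x).
  by rewrite /p; case: excluded_middle_informative => H; constructor.
have [al|la] := leqP a (size (filter p l)).
  left; apply: big_node al _; first exact: filter_uniq.
  by move=> x; rewrite mem_filter => /andP[/pP].
right; apply: (@big_node _ _ _ (filter (predC p) l)).
- exact: filter_uniq.
- rewrite -(leq_add2l a); apply: leq_trans kl _.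
  by rewrite -(count_predC p l) !size_filter leq_add2r -size_filter ltnW.
- move=> x; rewrite mem_filter => /andP[/= /pP nA xl].
  by case: (IH x xl).
Qed.

Lemma big_empty k A s : (forall t, ~ A t) -> ~ big k.+1 A s.
Proof.
move=> nA; elim=> {s} s => [/nA //|[|a l] _ // _ _ IH].
exact: (IH a (mem_head _ _)).
Qed.

(** Splitting off one set costs [k]; the extra 1 refutes the case of an empty union. *)
Lemma big_bigunion k m (A : nat -> seq nat -> Prop) s :
  big (m * k).+1 (fun t => exists2 i, i < m & A i t) s ->
  exists2 i, i < m & big k (A i) s.
Proof.
elim: m => [|m IHm].
  by rewrite mul0n => /big_empty[] // t [].
rewrite mulSn -addnS => H.
have {H} : big (k + (m * k).+1) (fun t => A m t \/ exists2 i, i < m & A i t) s.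
  apply: big_sub H => t [i]; rewrite ltnS leq_eqVlt => /orP[/eqP ->|im] Ai.
    by left.
  by right; exists i.
case/big_union => [|/IHm[i im] Ai]; first by exists m.
by exists i => //; apply: ltnW.
Qed.

(** Trees for [B] are grafted onto the leaves of the tree for [A]. *)
Lemma big_concat k A B s : big k A s ->
  (forall t, prefix s t -> A t -> big k B t) -> big k B s.
Proof.
elim=> {s} s => [As|l ul kl _ IH] H; first by apply: H; rewrite ?prefix_refl.
apply: big_node ul kl _ => a al; apply: IH => // t st; apply: H.
by apply: prefix_trans st; rewrite prefix_rcons.
Qed.

Lemma not_big_rcons k A s : ~ big k A s -> exists a, ~ big k A (rcons s a).
Proof.
move=> nA; apply: not_all_ex_not => H; apply: nA.
by apply: (@big_node _ _ _ (iota 0 k)); rewrite ?iota_uniq ?size_iota.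
Qed.

(* A string [t] is represented by the number [str_code t], reversed so that
   the one-element extensions of [t] are coded by the [pair a (str_code t)]. *)
Definition str (t : nat) : seq nat := rev (CodeSeq.decode t).
Definition str_code (s : seq nat) : nat := CodeSeq.code (rev s).

Lemma str_codeK : cancel str_code str.
Proof. by move=> s; rewrite /str CodeSeq.codeK revK. Qed.

Lemma str_code_rcons s a : str_code (rcons s a) = pair a (str_code s).
Proof. by rewrite pair_code /str_code rev_rcons CodeSeq.codeK. Qed.

(** A decidable test at stage [s]: [t] is seen to be a leaf, or has [k] children in the finite set
    [D]. The number [s] bounds both the stage of the approximation [a] and the labels of the
    children. *)
Definition tree_node (k : nat) (a : nat -> seq nat -> bool) (s : nat)
    (D : seq nat) (t : nat) : bool :=
  a s (str t) || (k <= count (fun b => pair b t \in D) (iota 0 s)).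

Lemma tree_node_mono k (a : nat -> seq nat -> bool) s s' D D' t :
  (forall u v, s <= v -> a s u -> a v u) -> s <= s' -> {subset D <= D'} ->
  tree_node k a s D t -> tree_node k a s' D' t.
Proof.
move=> a_mono ss' DD' /orP[at_|kD]; first by rewrite /tree_node a_mono.
apply/orP; right; apply: leq_trans kD _.
rewrite -(subnKC ss') iotaD count_cat.
by apply: leq_trans (leq_addr _ _); apply: sub_count => b /DD'.
Qed.

Definition finite_tree k a s D t : bool := (t \in D) && all (tree_node k a s D) D.

Lemma big_finite_tree k (a : nat -> seq nat -> bool) s :
  (forall u v t, u <= v -> a u t -> a v t) ->
  big k (fun t => exists u, a u t) s ->
  exists u D, forall v, u <= v -> finite_tree k a v D (str_code s).
Proof.
move=> a_mono; elim=> {s} s => [[u au]|l ul kl _ IH].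
  exists u, [:: str_code s] => v uv.
  by rewrite /finite_tree mem_head /= /tree_node str_codeK (a_mono u).
have [u [D HD]] : exists u D, forall v, u <= v ->
    [/\ all (fun b => b < u) l,
        forall b, b \in l -> str_code (rcons s b) \in D
      & all (tree_node k a v D) D].
  elim: l {ul kl} IH => [|b l IHl] IH; first by exists 0, [::].
  have [|u [D HD]] := IHl; first by move=> c cl; apply: IH; rewrite inE cl orbT.
  have [u' [D' HD']] := IH b (mem_head _ _).
  (* The term [b.+1] brings the label [b] below the bound on children. *)
  exists (maxn b.+1 (maxn u u')), (D ++ D') => v.
  rewrite !geq_max => /and3P[bv uv u'v].
  have [/allP lu lD nodeD] := HD v uv; have /andP[bD' nodeD'] := HD' v u'v.
  have catD E : {subset E <= D ++ D'} -> all (tree_node k a v E) E ->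
      all (tree_node k a v (D ++ D')) E.
    move=> ED; apply: sub_all => t; apply: tree_node_mono => // x y.
    exact: a_mono.
  split.
  - rewrite /= leq_max leqnn /=.
    by apply/allP => c /lu cu; rewrite !leq_max cu !orbT.
  - move=> c; rewrite inE mem_cat => /orP[/eqP ->|/lD ->] //.
    by rewrite bD' orbT.
  - by rewrite all_cat !catD // => x; rewrite mem_cat => -> //; rewrite orbT.
exists u, (str_code s :: D) => v uv; have [/allP lu lD nodeD] := HD v uv.
rewrite /finite_tree mem_head /=; apply/andP; split; last first.
  apply: sub_all nodeD => t; apply: tree_node_mono => // [x y|x xD].
    exact: a_mono.
  by rewrite inE xD orbT.
apply/orP; right; apply: leq_trans kl _; rewrite -size_filter.
apply: uniq_leq_size ul _ => b bl.
rewrite mem_filter mem_iota add0n inE -str_code_rcons lD // orbT /=.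
exact: leq_trans (lu b bl) uv.
Qed.

Lemma finite_tree_big k (a : nat -> seq nat -> bool) v D s :
  finite_tree k a v D (str_code s) -> big k (a v) s.
Proof.
case/andP=> sD /allP nodeD.
have [m mD] : exists m, forall t, t \in D -> t < m.
  exists (foldr maxn 0 D).+1 => t; rewrite ltnS.
  elim: D {sD nodeD} => //= u D IHD; rewrite inE leq_max.
  by case/orP=> [/eqP ->|/IHD ->]; rewrite ?leqnn ?orbT.
(* Codes grow strictly from a string to its children and are bounded on [D], so the descent through
   [D] ends in leaves. *)
move: {2}(m - str_code s) (leqnn (m - str_code s)) => n.
elim: n s sD => [|n IHn] s sD.
  by rewrite leqn0 subn_eq0 leqNgt mD.
move=> sn; case/orP: (nodeD _ sD); first by rewrite str_codeK; left.
rewrite -size_filter => kD; apply: big_node kD _.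
  by rewrite filter_uniq ?iota_uniq.
move=> b; rewrite mem_filter -str_code_rcons => /andP[bD _].
apply: IHn => //; rewrite -ltnS; apply: leq_trans sn.
by rewrite ltn_sub2l ?mD // str_code_rcons ltn_pairr.
Qed.
(** * Forcing one column *)

(** Column [n] is overwritten by [g]. The guard is there because [hd 0] is 0 although position 0
    lies in no column. *)
Definition upd (C : nat -> nat) (n : nat) (g : nat -> nat) : nat -> nat :=
  fun p => if (p != 0) && (hd p == n) then g (tl p) else C p.

(** The partial oracle known when only the initial segment [s] of column [n] is decided. *)
Definition upd_str (C : nat -> nat) (n : nat) (s : seq nat) : nat -> nat :=
  fun p => if (p != 0) && (hd p == n) then nth 0 (map succn s) (tl p)
           else (C p).+1.

Lemma upd_str_prefix C n s t : prefix s t -> extends (upd_str C n s) (upd_str C n t).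
Proof.
case/prefixP=> t' -> p; rewrite /upd_str; case: ifP => // _.
rewrite map_cat nth_cat; case: ltnP => // sp.
by rewrite nth_default.
Qed.

Lemma upd_str_upd C n g m : extends (upd_str C n (mkseq g m)) (succn \o upd C n g).
Proof.
move=> p; rewrite /upd_str /upd /=; case: ifP => // _.
have [pm|mp] := ltnP (tl p) m; last by rewrite nth_default ?size_map ?size_iota.
by rewrite (nth_map 0) ?size_mkseq // nth_mkseq.
Qed.

Lemma upd_str_mkseq C n g m p :
  p < m -> upd_str C n (mkseq g m) p = (upd C n g p).+1.
Proof.
move=> pm; rewrite /upd_str /upd; case: ifP => // _.
have tm := leq_ltn_trans (tl_leq p) pm.
by rewrite (nth_map 0) ?size_mkseq // nth_mkseq.
Qed.

Lemma computable_upd_str C n :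
  computable C 2 (fun r => upd_str C n (str (r 0)) (r 1)).
Proof.
apply: computable_if.
- apply: computable_and; first exact/computable_neg/computable_eq0/computable_var.
  apply: computable_eq (computable_const _ _ _).
  exact/computable_hd/computable_var.
- apply: computable_lookup; first exact: computable_var.
  exact/computable_tl/computable_var.
- exact/computable_Succ/computable_oracle/computable_var.
Qed.

(** The argument [e] is an index, so that a single universal program [c] covers all functionals. *)
Definition forces_value C n c e x i (v : nat) (s : seq nat) : bool :=
  run (upd_str C n s) v c [:: e; x] == i.+1.

Lemma forces_value_mono C n c e x i u v s t : u <= v -> prefix s t ->
  forces_value C n c e x i u s -> forces_value C n c e x i v t.
Proof.
move=> uv st /eqP E; apply/eqP.
by rewrite (run_mono (upd_str_prefix st) uv) E.
Qed.

(** Members of a list lie below its code, so the quantifier becomes a bounded one, fit for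
    [computable_all]. *)
Lemma all_decode (p : pred nat) d : all p (CodeSeq.decode d) =
  all (fun t => (t \in CodeSeq.decode d) ==> p t) (iota 0 d).
Proof.
apply/allP/allP => pd t; first by move=> _; apply/implyP/pd.
move=> td; apply: (implyP (pd t _)) => //; rewrite mem_iota add0n.
exact: allP (CodeSeq.gtn_decode d) t td.
Qed.

(** Bigness has finite certificates checkable from [C]. The search runs over codes [w] of triples: a
    value, a stage and a finite tree. *)
Lemma bushy_selector h C n c e k s : recursive h ->
  (forall x, exists2 i, i < h x &
     big k (fun t => exists v, forces_value C n c e x i v t) s) ->
  exists d g, forall x, [/\ eval C d [:: x] (g x), g x < h x &
    big k (fun t => exists v, forces_value C n c e x (g x) v t) s].
Proof.
move=> [ch Hch] Hbig.
(* The encoded empty oracle is [fun=> 1]. A defined run returns [(h x).+1], so the test says that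
   the value is below [h x]; an undefined run fails it. *)
pose found w x := (hd w).+1 < run (fun=> 1) (hd (tl w)) ch [:: x].
pose tree w x := finite_tree k (forces_value C n c e x (hd w)) (hd (tl w))
  (CodeSeq.decode (tl (tl w))) (str_code s).
have ex (r : nat -> nat) : exists w, found w (r 0) && tree w (r 0).
  have [i ih /big_finite_tree[u v t uv|u [D HD]]] := Hbig (r 0).
    by apply: forces_value_mono => //; apply: prefix_refl.
  have [u' Hu'] := run_complete (Hch (r 0)).
  exists (pair i (pair (maxn u u') (CodeSeq.code D))).
  rewrite /found /tree !(hd_pair, tl_pair) CodeSeq.codeK.
  by rewrite Hu' ?leq_maxr // ltnS ih HD // leq_maxl.
have : computable C 1 (fun r => hd (ex_minn (ex r))).
  apply: computable_hd.
  apply: (@computable_least _ _ (fun w r => found w (r 0) && tree w (r 0))).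
  have comp_s l i : i < l -> computable C l (fun r => hd (tl (r i))).
    by move=> il; apply/computable_hd/computable_tl/computable_var.
  have comp_d l i : i < l -> computable C l (fun r => tl (tl (r i))).
    by move=> il; do 2!apply: computable_tl; apply: computable_var.
  have comp_i l i : i < l -> computable C l (fun r => (hd (r i)).+1).
    by move=> il; apply/computable_Succ/computable_hd/computable_var.
  apply: computable_and.
    apply: computable_leq; first by apply: computable_Succ; apply: comp_i.
    have comp_1 : computable C 2 (fun=> 1) by apply: computable_const.
    apply: (computable_subst (g := fun i r => match i with
      | 0 => hd (tl (r 0)) | 1 => 0 | _ => r 1 end)
      (@run_computable C (fun _ _ => 1) ch 1 comp_1)).
    case=> [|[|i]] _; [exact: comp_s | exact: computable_const |].
    exact: computable_var.
  apply: computable_and.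
    by apply: computable_mem_decode; [apply: computable_const | apply: comp_d].
  apply: computable_ext => [r|]; first by rewrite all_decode; reflexivity.
  apply: (@computable_all _ _ (fun t r => (t \in CodeSeq.decode (tl (tl (r 0)))) ==>
    tree_node k (forces_value C n c e (r 1) (hd (r 0))) (hd (tl (r 0)))
      (CodeSeq.decode (tl (tl (r 0)))) t)); last exact: comp_d.
  (* From here variable 0 is the node, variable 1 the triple and variable 2 the input [x]. *)
  apply: (@computable_ext _ _ (fun r =>
    (r 0 \notin CodeSeq.decode (tl (tl (r 1)))) ||
    tree_node k (forces_value C n c e (r 2) (hd (r 1))) (hd (tl (r 1)))
      (CodeSeq.decode (tl (tl (r 1)))) (r 0))).
    by move=> r; rewrite implybE.
  apply: computable_or.
    apply/computable_neg/computable_mem_decode; last exact: comp_d.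
    exact: computable_var.
  apply: computable_or.
    apply: computable_eq; last exact: comp_i.
    apply: (computable_subst (g := fun i r => match i with
      | 0 => hd (tl (r 1)) | 1 => r 0 | 2 => e | _ => r 2 end)
      (@run_computable C (fun t => upd_str C n (str t)) c 2 (computable_upd_str C n))).
    case=> [|[|[|i]]] _; [exact: comp_s | exact: computable_var | |].
      exact: computable_const.
    exact: computable_var.
  apply: computable_leq; first exact: computable_const.
  apply: (@computable_count _ _ (fun b r =>
    pair b (r 0) \in CodeSeq.decode (tl (tl (r 1))))); last exact: comp_s.
  apply: computable_mem_decode; last exact: comp_d.
  by apply: computable_pair; apply: computable_var.
case=> d Hd; exists d, (fun x => hd (ex_minn (ex (fun=> x)))) => x.
split; first exact: (Hd (fun=> x)).
  case: ex_minnP => w /andP[fw _] _; move: fw; rewrite /found.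
  case E: (run _ _ _ _) => [|y] //; rewrite ltnS.
  have PG : extends (fun=> 1) (succn \o empty_oracle) by [].
  by rewrite (eval_functional (run_sound PG E) (Hch x)).
case: ex_minnP => w /andP[_ /finite_tree_big] /big_sub + _; apply=> t at_.
by exists (hd (tl w)).
Qed.

Definition computes_no_bounded_DNR Phi (h C : nat -> nat) :=
  ~ exists c H, (forall x, eval C c [:: x] (H x)) /\ bounded_DNR Phi h H.

Definition upward_closed (B : seq nat -> Prop) :=
  forall s t, prefix s t -> B s -> B t.

(** One forcing step against index [e]. Strict growth of the stem makes the stems of successive
    steps converge to a total function. *)
Lemma force_noncomputation Phi h C n c e s k B :
  recursive h -> computes_no_bounded_DNR Phi h C ->
  upward_closed B -> ~ big k B s ->
  exists s' k' B', [/\ prefix s s' /\ size s < size s',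
    forall t, B t -> B' t, upward_closed B', ~ big k' B' s' &
    forall f, (forall m, ~ B' (mkseq f m)) -> s' = mkseq f (size s') ->
      ~ exists H, (forall x, eval (upd C n f) c [:: e; x] (H x)) /\
                  bounded_DNR Phi h H].
Proof.
move=> hrec weakC upB nB.
(* Strictness is obtained afterwards: some one-entry extension keeps the bad set small. *)
suff [s' [k' [B' [ss' BB' upB' nB' Hf]]]] : exists s' k' B',
    [/\ prefix s s', forall t, B t -> B' t, upward_closed B', ~ big k' B' s' &
    forall f, (forall m, ~ B' (mkseq f m)) -> s' = mkseq f (size s') ->
      ~ exists H, (forall x, eval (upd C n f) c [:: e; x] (H x)) /\
                  bounded_DNR Phi h H].
  have [a nB'a] := not_big_rcons nB'.
  exists (rcons s' a), k', B'; split=> //.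
    split; first exact: prefix_trans (prefix_rcons _ _).
    by rewrite size_rcons ltnS; apply: size_prefix.
  move=> f fB fs; apply: Hf => //.
  move/(congr1 (take (size s'))): fs.
  rewrite -cats1 take_size_cat // => {1}->.
  rewrite size_cat addn1 /mkseq -map_take take_iota.
  by rewrite (minn_idPl (leqnSn _)).
pose A x i t := exists v, forces_value C n c e x i v t.
pose U x t := exists2 i, i < h x & A x i t.
have upA x i : upward_closed (A x i).
  move=> t t' tt' [v Hv]; exists v; exact: forces_value_mono Hv.
have [bigU|] := classic (forall x, big (h x * k).+1 (U x) s).
- have [d [g Hg]] := bushy_selector hrec (fun x => big_bigunion (bigU x)).
  (* The selector [g] is computable from [C] and bounded by [h], so the invariant makes it fail to
     be DNR. *)
  have [x [y [Pxy gx]]] : exists x y, Phi x empty_oracle x y /\ g x = y.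
    apply: NNPP => nDNR; apply: weakC; exists d, g.
    split=> [x|]; first by have [] := Hg x.
    split=> [x y Pxy gx|x]; first by apply: nDNR; exists x, y.
    by have [] := Hg x.
  have [_ _ bigA] := Hg x.
  (* If [B] were [k]-big above every such leaf, grafting would make it [k]-big above [s]. *)
  have [t [st [v At] nBt]] : exists t, [/\ prefix s t, A x (g x) t & ~ big k B t].
    apply: NNPP => nt; apply: nB; apply: big_concat bigA _ => t st At.
    by apply: NNPP => nBt; apply: nt; exists t.
  exists t, k, B; split=> // f _ ft [H [HH [dnrH _]]].
  apply: (dnrH x y Pxy); rewrite -gx.
  apply: eval_functional (HH x) _; apply: run_sound (eqP At).
  by rewrite ft; apply: upd_str_upd.
- case/not_all_ex_not=> x nU.
  (* The new bushiness is the sum of the two bounds, as [big_union] requires. *)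
  exists s, (k + (h x * k).+1), (fun t => B t \/ U x t); split.
  + exact: prefix_refl.
  + by left.
  + move=> t t' tt' [/(upB _ _ tt')|[i ih /(upA _ _ _ _ tt')]]; first by left.
    by right; exists i.
  + by case/big_union.
  move=> f fB _ [H [HH [_ Hh]]].
  have [v Hv] := run_complete (HH x).
  (* A computation of a value below [h x] uses only a finite part of [f], and that initial segment
     has been declared bad. *)
  apply: (fB v); right; exists (H x) => //; exists v; apply/eqP.
  by apply: Hv => // p pv; apply: upd_str_mkseq.
Qed.

Lemma dependent_choice_seq (T : Type) (Q : nat -> T -> T -> Prop) (x0 : T) :
  (forall n x, exists y, Q n x y) ->
  exists f : nat -> T, f 0 = x0 /\ forall n, Q n (f n) (f n.+1).
Proof.
move=> H; pose next n x := proj1_sig (constructive_indefinite_description _ (H n x)).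
exists (fun n => iteri n next x0); split=> // n.
exact: proj2_sig (constructive_indefinite_description _ (H n _)).
Qed.

(** * Construction of one generic column *)

Record condition := Condition {
  stem : seq nat;
  bushiness : nat;
  bad : seq nat -> Prop;
  bad_upward_closed : upward_closed bad;
  bad_small : ~ big bushiness bad stem }.

Lemma prefix_mkseq (T : eqType) (f : nat -> T) m n :
  m <= n -> prefix (mkseq f m) (mkseq f n).
Proof.
by move=> mn; rewrite -(subnKC mn) /mkseq iotaD map_cat prefix_prefix.
Qed.

(** Stage [e] forces against index [e] of the universal program [u]; the column is the limit of the
    stems and avoids all bad sets. *)
Lemma DNR_column Phi h C n :
  standard_enumeration Phi -> recursive h -> computes_no_bounded_DNR Phi h C ->
  exists g, DNR_rel Phi C g /\ computes_no_bounded_DNR Phi h (upd C n g).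
Proof.
move=> [[u Hu] smn] hrec weakC.
pose bad0 t := exists2 x, x < size t & Phi x C x (nth 0 t x).
have up0 : upward_closed bad0.
  move=> s t /prefixP[t' ->] [x xs Hx]; exists x.
    by rewrite size_cat ltn_addr.
  by rewrite nth_cat xs.
(* If two distinct children are bad, their last entries cannot both equal the unique value of the
   computation, so the parent is bad already; the empty string is not. *)
have small0 : ~ big 2 bad0 [::].
  suff H s : big 2 bad0 s -> bad0 s by move=> /H[].
  elim=> {s} // s [|a [|b l]] // /andP[]; rewrite inE negb_or => /andP[ab _] _ _ _ IH.
  have [xa sa Ha] := IH a (mem_head _ _).
  have [xb sb Hb] : bad0 (rcons s b) by apply: IH; rewrite !inE eqxx orbT.
  move: sa sb Ha Hb; rewrite !size_rcons !ltnS !nth_rcons.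
  rewrite leq_eqVlt => /orP[/eqP ->|xas _]; last by rewrite xas; exists xa.
  rewrite leq_eqVlt => /orP[/eqP ->|xbs _]; last by rewrite xbs; exists xb.
  rewrite ltnn eqxx => /Hu Ha /Hu Hb.
  by rewrite (eval_functional Ha Hb) eqxx in ab.
pose Q e p q := [/\ prefix (stem p) (stem q), size (stem p) < size (stem q),
  forall t, bad p t -> bad q t &
  forall f, (forall m, ~ bad q (mkseq f m)) -> stem q = mkseq f (size (stem q)) ->
    ~ exists H, (forall x, eval (upd C n f) u [:: e; x] (H x)) /\
                bounded_DNR Phi h H].
have [p [p0 Hp]] : exists p, p 0 = Condition up0 small0 /\
    forall e, Q e (p e) (p e.+1).
  apply: dependent_choice_seq => e [s k B upB nB].
  have [s' [k' [B' [[ss' sizes'] BB' upB' nB' Hf]]]] :=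
    force_noncomputation n u e hrec weakC upB nB.
  by exists (Condition upB' nB').
have mono i j : i <= j -> prefix (stem (p i)) (stem (p j)) /\
    forall t, bad (p i) t -> bad (p j) t.
  move=> /subnKC <-; elim: (j - i) => [|m [IHp IHb]].
    by rewrite addn0 prefix_refl.
  rewrite addnS; have [pm _ bm _] := Hp (i + m).
  by split=> [|t /IHb /bm]; first exact: prefix_trans pm.
have size_stem i : i <= size (stem (p i)).
  elim: i => // i IHi; have [_ ltm _ _] := Hp i; exact: leq_ltn_trans ltm.
pose f x := nth 0 (stem (p x.+1)) x.
have stemE i : stem (p i) = mkseq f (size (stem (p i))).
  apply: (@eq_from_nth _ 0) => [|x xi]; first by rewrite size_mkseq.
  rewrite nth_mkseq // /f; have xs := size_stem x.+1.
  have [ix|xi'] := leqP i x.+1.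
    by have [/prefixP[t ->] _] := mono _ _ ix; rewrite nth_cat xi.
  by have [/prefixP[t ->] _] := mono _ _ (ltnW xi'); rewrite nth_cat xs.
(* A bad initial segment would make a later stem bad, and hence big as a leaf. *)
have not_bad i m : ~ bad (p i) (mkseq f m).
  have [_ bi] := mono _ _ (leq_maxl i m); move/bi.
  move/(bad_upward_closed (prefix_mkseq f
    (leq_trans (leq_maxr i m) (size_stem (maxn i m))))).
  by rewrite -stemE => /big_leaf /bad_small.
exists f; split.
  move=> x y Hxy fx; apply: (not_bad 0 x.+1); rewrite p0; exists x.
    by rewrite size_mkseq.
  by rewrite nth_mkseq // fx.
case=> c [H [Hc dnrH]].
(* The program ignores its first argument, so [s 0] is an index of [c], and stage [s 0] has dealt
   with it. *)
have [s _ Hs] := smn (Comp c [:: Proj 1]).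
have [_ _ _ /(_ f (not_bad _) (stemE _)) []] := Hp (s 0).
exists H; split=> // x; apply/Hu/Hs.
apply: eval_Comp (Hc x); constructor; last by constructor.
exact: (@eval_Proj _ 1 [:: 0; x]).
Qed.

(** A recursive [H] has an index [e], and then [H e] is the value of the diagonal computation at
    [e]. *)
Lemma empty_computes_no_bounded_DNR Phi h :
  standard_enumeration Phi -> computes_no_bounded_DNR Phi h empty_oracle.
Proof.
move=> [_ smn] [c [H [Hc [dnrH _]]]].
have [s _ Hs] := smn (Comp c [:: Proj 1]).
apply: (dnrH (s 0) (H (s 0))) => //; apply/Hs.
apply: eval_Comp (Hc _); constructor; last by constructor.
exact: (@eval_Proj _ 1 [:: 0; s 0]).
Qed.

(** * Joins of columns *)

Lemma join_pair G m a b :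
  join G m (pair a b) = if a < m then column G a b else 0.
Proof.
rewrite /join -/(column _ a b) column_oplus.
by case: ifP.
Qed.

Lemma eq_from_pair (F F' : nat -> nat) :
  F 0 = F' 0 -> (forall a b, F (pair a b) = F' (pair a b)) -> F = F'.
Proof.
move=> F0 H; apply: functional_extensionality => x.
by have [->|/pair_hd_tl <-] := eqVneq x 0.
Qed.

Lemma join0 G : join G 0 = empty_oracle.
Proof. by apply: eq_from_pair => // a b; rewrite join_pair. Qed.

Lemma joinS G m : join G m.+1 = upd (join G m) m (column G m).
Proof.
apply: eq_from_pair => // a b.
rewrite /upd pair_neq0 hd_pair tl_pair !join_pair ltnS leq_eqVlt.
by case: eqVneq => [->|].
Qed.

(** Joins are padded with zeros, so the zero odd columns leave them unchanged. *)
Lemma joinS_zero G m : column G m = empty_oracle -> join G m.+1 = join G m.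
Proof.
move=> Gm; apply: eq_from_pair => // a b; rewrite !join_pair ltnS leq_eqVlt.
by case: eqVneq => [->|] //; rewrite Gm ltnn.
Qed.

(** * Assembly of the columns *)

Theorem theorem1p5 (Phi : nat -> functional) (hPhi : standard_enumeration Phi)
    (h : nat -> nat) (hrec : recursive h) :
  exists G : nat -> nat,
    relatively_DNR Phi G /\
    forall Psi : functional, turing_functional Psi ->
    forall i : nat,
      ~ exists H : nat -> nat,
          (forall x, Psi (join G i.+1) x (H x)) /\ bounded_DNR Phi h H.
Proof.
pose weak := computes_no_bounded_DNR Phi h.
(* [C y] is the join of the columns below [2 * y]; passing to [C y.+1] installs column [2 * y]. The
   invariant is packed into the type. *)
pose Q y (C C' : {C | weak C}) :=
  exists g, DNR_rel Phi (sval C) g /\ sval C' = upd (sval C) (2 * y) g.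
have [C [C0 HC]] : exists C, C 0 = exist weak _
    (empty_computes_no_bounded_DNR hPhi) /\ forall y, Q y (C y) (C y.+1).
  apply: dependent_choice_seq => y [C weakC].
  have [g [dnrg weakg]] := DNR_column (2 * y) hPhi hrec weakC.
  by exists (exist weak _ weakg), g.
pose g y := proj1_sig (constructive_indefinite_description _ (HC y)).
have gP y : DNR_rel Phi (sval (C y)) (g y) /\
    sval (C y.+1) = upd (sval (C y)) (2 * y) (g y).
  exact: proj2_sig (constructive_indefinite_description _ (HC y)).
pose G := oplus (fun m => if odd m then empty_oracle else g m./2).
have colE m : column G m = if odd m then empty_oracle else g m./2.
  by apply: functional_extensionality => k; rewrite column_oplus.
have col_even y : column G (2 * y) = g y.
  by rewrite colE mul2n odd_double doubleK.
have join_even y : join G (2 * y) = sval (C y).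
  elim: y => [|y IHy]; first by rewrite muln0 join0 C0.
  rewrite mulnS joinS_zero ?joinS ?IHy ?col_even ?(proj2 (gP y)) //.
  by rewrite colE mul2n /= odd_double.
have join_odd y : join G (2 * y).+1 = sval (C y.+1).
  by rewrite joinS join_even col_even (proj2 (gP y)).
(* By parity of [m], every finite join is one of the [C y]. *)
have weak_join m : weak (join G m).
  rewrite -(odd_double_half m) -mul2n.
  by case: (odd m); rewrite ?add1n ?add0n ?join_odd ?join_even; apply: svalP.
exists G; split.
  case=> x [y]; rewrite join_even col_even => Hx.
  exact: (proj1 (gP y)) Hx erefl.
move=> Psi [c Hc] i [H [HH dnrH]]; apply: (weak_join i.+1).
by exists c, H; split=> // x; apply/Hc.
Qed.
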